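(* Let $m\ge3$ and $n\ge 3$. An $m$-strategy CRS game with $n$ players on a line or on a ring admits a pure strategy Nash equilibrium (PNE) if and only if every conformist has at least one neighbor who is either a conformist or a stubborn agent, i.e. $N_i\cap(C\cup S)\ne\emptyset$ for all $i\in C$.
   Context: An $m$-strategy CRS game consists of a finite set of players $N=C\cup R\cup S$ (disjoint union of conformists $C$, rebels $R$ and stubborn agents $S$), a set $E\neq\emptyset$ of undirected edges on $N$ without loops, and a strategy set $A=\{a_1,\dots,a_m\}$ common to all players. $N_i=\{j: ij\in E\}$ is the set of neighbors of $i$. The game is on a line if the players can be labelled $1,\dots,n$ so that $E=\{12,23,\dots,(n-1)n\}$, and on a ring if they can be labelled so that $E=\{12,23,\dots,(n-1)n,n1\}$. Each stubborn agent has a predetermined fixed strategy in $A$ which it never changes, so strategy profiles $\boldsymbol x\in A^N$ always have $x_i$ equal to the fixed strategy for $i\in S$. Payoffs are $u_i(\boldsymbol x)=|\{j\in N_i: x_j=x_i\}|$ for $i\in C$, $u_i(\boldsymbol x)=|\{j\in N_i: x_j\ne x_i\}|$ for $i\in R$, and $u_i(\boldsymbol x)=0$ for $i\in S$. A profile $\boldsymbol x^*$ is a PNE if no conformist or rebel $i$ can strictly increase $u_i$ by unilaterally changing its strategy: $u_i(\boldsymbol x^* )\ge u_i(x_i,\boldsymbol x^*_{-i})$ for all $x_i\in A$. *)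

(* Defs.v *)
From mathcomp Require Import all_boot.

Set Implicit Arguments.
Unset Strict Implicit.
Unset Printing Implicit Defensive.

(* Any of the three classes of players may be empty.                          *)
Record crs_game (N A : finType) : Type := CrsGame {
  conformists : {set N};
  rebels : {set N};
  stubborn : {set N};
  edges : {set {set N}};
  fixed : {i : N | i \in stubborn} -> A;
  players_cover : conformists :|: rebels :|: stubborn = [set: N];
  conformists_rebels_disjoint : [disjoint conformists & rebels];
  conformists_stubborn_disjoint : [disjoint conformists & stubborn];
  rebels_stubborn_disjoint : [disjoint rebels & stubborn];
  edges_are_pairs : forall e : {set N}, e \in edges -> #|e| = 2;
  edges_nonempty : edges != set0
}.

Section CrsGame.
Variables (N A : finType) (G : crs_game N A).

Definition neighbors (i : N) : {set N} := [set j | [set i; j] \in edges G].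

Definition is_profile (x : {ffun N -> A}) : Prop :=
  forall s : {i : N | i \in stubborn G}, x (val s) = fixed s.

Definition deviate (x : {ffun N -> A}) (i : N) (a : A) : {ffun N -> A} :=
  [ffun j => if j == i then a else x j].

Definition payoff (x : {ffun N -> A}) (i : N) : nat :=
  if i \in conformists G then #|[set j in neighbors i | x j == x i]|
  else if i \in rebels G then #|[set j in neighbors i | x j != x i]|
  else 0.

Definition PNE (x : {ffun N -> A}) : Prop :=
  is_profile x /\
  forall i : N, i \in conformists G :|: rebels G ->
    forall a : A, payoff (deviate x i a) i <= payoff x i.

(* Labels run over 0, ..., n-1 instead of 1, ..., n.                          *)
Definition on_line : Prop :=
  exists label : 'I_#|N| -> N, bijective label /\
    edges G = [set [set label i; label j]
                | i in 'I_#|N|, j in 'I_#|N| & (j == i.+1 :> nat)].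

(* ordS is the cyclic successor, so that the last label precedes the first.   *)
Definition on_ring : Prop :=
  exists label : 'I_#|N| -> N, bijective label /\
    edges G = [set [set label i; label (ordS i)] | i : 'I_#|N|].

End CrsGame.

(* Main.v *)
Require Import Defs.
From mathcomp Require Import all_boot.

(** On a graph of maximum degree at most 2 with at least three strategies, a
    rebel can always differ from all its neighbors, and a conformist plays a best
    response as soon as it agrees with one neighbor: two agreements are available
    only if both neighbors play the same strategy.  Hence in a PNE a conformist
    with only rebel neighbors would agree with none of them and deviate.
    Conversely, give one common strategy to all the conformists that have a
    conformist neighbor, let the other conformists copy a stubborn neighbor, and
    then choose the strategies of the rebels greedily, in any order. *)

Set Implicit Arguments.
Unset Strict Implicit.
Unset Printing Implicit Defensive.

Lemma set2_eq (T : finType) (a b c d : T) :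
  [set a; b] = [set c; d] -> (a = c /\ b = d) \/ (a = d /\ b = c).
Proof.
move=> e.
have: a \in [set c; d] by rewrite -e set21.
have: b \in [set c; d] by rewrite -e set22.
have: c \in [set a; b] by rewrite e set21.
have: d \in [set a; b] by rewrite e set22.
by rewrite !inE => /pred2P[]-> /pred2P[]-> /pred2P[]? /pred2P[]?; subst; auto.
Qed.

(** Pigeonhole: the image of [D] under [f] has at most [#|D|] elements. This supplies every strategy
    that a rebel uses to disagree with all its neighbors. *)
Lemma exists_avoiding (T A : finType) (f : T -> A) (D : {set T}) :
  #|D| < #|A| -> exists a, forall j, j \in D -> f j != a.
Proof.
move=> lDA; have : f @: D \proper [set: A].
  rewrite properEcard subsetT cardsT.
  exact: leq_ltn_trans (leq_imset_card _ _) lDA.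
case/properP=> _ [a _ aN]; exists a => j jD.
by apply: contraNneq aN => <-; apply: imset_f.
Qed.

Section Game.
Variables (N A : finType) (G : crs_game N A).
Implicit Types (x : {ffun N -> A}) (i j : N) (a : A) (D : {set N}).

Lemma neighbors_sym i j : (i \in neighbors G j) = (j \in neighbors G i).
Proof. by rewrite !inE setUC. Qed.

Lemma neighbors_irrefl i : i \notin neighbors G i.
Proof. by rewrite inE setUid; apply/negP => /edges_are_pairs; rewrite cards1. Qed.

Lemma neighbor_neq i j : j \in neighbors G i -> j != i.
Proof. by apply: contraTneq => ->; apply: neighbors_irrefl. Qed.

Lemma deviate_self x i a : deviate x i a i = a.
Proof. by rewrite ffunE eqxx. Qed.

Lemma deviate_neighbor x i a j : j \in neighbors G i -> deviate x i a j = x j.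
Proof. by move/neighbor_neq/negPf=> ji; rewrite ffunE ji. Qed.

Lemma rebel_not_conformist i : i \in rebels G -> i \in conformists G = false.
Proof. exact: disjointFl (conformists_rebels_disjoint G). Qed.

Lemma payoff_deviate_conformist x i a : i \in conformists G ->
  payoff G (deviate x i a) i = #|[set j in neighbors G i | x j == a]|.
Proof.
move=> iC; rewrite /payoff iC deviate_self; apply: eq_card => j.
rewrite !in_set; case: (boolP ([set i; j] \in edges G)) => //= ij.
by rewrite deviate_neighbor // inE.
Qed.

Lemma payoff_deviate_rebel x i a : i \in rebels G ->
  payoff G (deviate x i a) i = #|[set j in neighbors G i | x j != a]|.
Proof.
move=> iR; rewrite /payoff (rebel_not_conformist iR) iR deviate_self.
apply: eq_card => j.
rewrite !in_set; case: (boolP ([set i; j] \in edges G)) => //= ij.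
by rewrite deviate_neighbor // inE.
Qed.

Lemma PNE_rebel_neq x i j :
    #|neighbors G i| < #|A| -> PNE G x -> i \in rebels G ->
  j \in neighbors G i -> x j != x i.
Proof.
move=> dA [_ xP] iR jN.
have [a aP] := exists_avoiding x dA.
have := xP i; rewrite inE iR orbT => /(_ isT a).
rewrite payoff_deviate_rebel // /payoff (rebel_not_conformist iR) iR.
rewrite (_ : [set k in neighbors G i | x k != a] = neighbors G i); last first.
  by apply/setP=> k; rewrite inE; apply: andb_idr => /aP.
(* Deviating to [a] would earn the full degree, so at equilibrium the disagreeing neighbors already
   exhaust the neighborhood. *)
move=> le; have /eqP e : [set k in neighbors G i | x k != x i] == neighbors G i.
  by rewrite eqEcard le andbT; apply/subsetP=> k; rewrite inE => /andP[].
by move: jN; rewrite -e inE => /andP[].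
Qed.

Lemma conformist_best_response x i j a :
    #|neighbors G i| <= 2 -> i \in conformists G ->
    j \in neighbors G i -> x j = x i ->
  payoff G (deviate x i a) i <= payoff G x i.
Proof.
move=> d2 iC jN xj; rewrite payoff_deviate_conformist // /payoff iC.
have [->//|ax] := eqVneq a (x i).
(* The value 1 separates the two payoffs: [j] agrees now, and for [a != x i] it is lost, leaving at
   most one other neighbor. *)
apply: (@leq_trans 1); last first.
  by rewrite card_gt0; apply/set0Pn; exists j; rewrite inE jN xj eqxx.
rewrite -ltnS; apply: leq_trans d2; apply: proper_card; apply/properP; split.
  by apply/subsetP=> k; rewrite inE => /andP[].
by exists j => //; rewrite inE jN xj eq_sym.
Qed.

Lemma rebel_best_response x i a : i \in rebels G ->
    (forall j, j \in neighbors G i -> x j != x i) ->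
  payoff G (deviate x i a) i <= payoff G x i.
Proof.
move=> iR xP; rewrite payoff_deviate_rebel // /payoff (rebel_not_conformist iR) iR.
apply: subset_leq_card; apply/subsetP=> j; rewrite !in_set => /andP[jN _].
by rewrite jN xP ?inE.
Qed.

(** Induction on [#|D|]: recolor [D :\ i] first, then give [i] a strategy that none of its neighbors
    plays. Pairs containing [i] are settled by this choice, and all other pairs are left
    unchanged. *)
Lemma greedy_recoloring x D :
    (forall i, i \in D -> #|neighbors G i| < #|A|) ->
  exists y : {ffun N -> A}, (forall i, i \notin D -> y i = x i) /\
    (forall i j, i \in D -> j \in neighbors G i -> y j != y i).
Proof.
have [k] := ubnP #|D|; elim: k D => // k IH D ltD degD.
have [->|/set0Pn[i iD]] := eqVneq D set0.
  by exists x; split=> // i j; rewrite inE.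
have [||y [yx yP]] := IH (D :\ i).
- by move: ltD; rewrite (cardsD1 i) iD.
- by move=> j /setD1P[_]; apply: degD.
have [a aP] := exists_avoiding y (degD i iD).
exists (deviate y i a); split=> [j jD|j l jD lN].
  have ji : j != i by apply: contraNneq jD => ->.
  by rewrite ffunE (negPf ji) yx // inE negb_and jD orbT.
have [e|ji] := eqVneq j i.
  by move: lN; rewrite e => lN; rewrite deviate_self deviate_neighbor // aP.
rewrite [deviate y i a j]ffunE (negPf ji).
have [e|li] := eqVneq l i.
  by rewrite e deviate_self eq_sym aP // neighbors_sym -e.
by rewrite ffunE (negPf li) yP // in_setD1 ji.
Qed.

Lemma conformist_has_ally_of_PNE x i :
    (forall j, #|neighbors G j| < #|A|) -> neighbors G i != set0 ->
    PNE G x -> i \in conformists G ->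
  neighbors G i :&: (conformists G :|: stubborn G) != set0.
Proof.
move=> degA /set0Pn[j jN] xP iC; apply/negP => /eqP noally.
(* Without allies every neighbor [k] is a rebel, so its own equilibrium condition makes it differ
   from [i]. *)
have rebN k : k \in neighbors G i -> x k != x i.
  move=> kN; rewrite eq_sym; apply: (PNE_rebel_neq (degA k)) => //; last first.
    by rewrite neighbors_sym.
  have : k \in [set: N] by [].
  rewrite -(players_cover G) !in_setU.
  have : k \notin neighbors G i :&: (conformists G :|: stubborn G).
    by rewrite noally inE.
  by rewrite in_setI kN in_setU negb_or => /andP[/negPf-> /negPf->]; rewrite orbF.
case: xP => _ /(_ i); rewrite inE iC => /(_ isT (x j)).
rewrite payoff_deviate_conformist // leqNgt => /negP[].
rewrite /payoff iC (_ : [set k in neighbors G i | x k == x i] = set0); last first.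
  apply/setP=> k; rewrite in_set0 in_set; apply/negP => /andP[kN].
  by rewrite (negPf (rebN k kN)).
by rewrite cards0 card_gt0; apply/set0Pn; exists j; rewrite in_set jN eqxx.
Qed.

Lemma exists_PNE :
    (forall i, #|neighbors G i| <= 2) -> 2 < #|A| ->
    (forall i, i \in conformists G ->
       neighbors G i :&: (conformists G :|: stubborn G) != set0) ->
  exists x : {ffun N -> A}, PNE G x.
Proof.
move=> deg2 A3 ally.
have /card_gt0P[a0 _] : 0 < #|A| by apply: leq_trans A3.
(* [fixed] lives on a subtype; [f0] extends it to all players with default [a0]. *)
pose f0 i := if insub i is Some s then fixed (c := G) s else a0.
have f0C i : i \in conformists G -> f0 i = a0.
  move=> iC; rewrite /f0 insubN //.
  by rewrite (disjointFr (conformists_stubborn_disjoint G) iC).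
(* Rebels get a provisional value, to be overwritten by the greedy recoloring. The final [a0] of the
   conformist case is a default that [ally] excludes. *)
pose f i := if i \in conformists G then
    if [pick j in neighbors G i :&: conformists G] is Some _ then a0
    else if [pick j in neighbors G i :&: stubborn G] is Some j then f0 j else a0
  else f0 i.
have [i _|y [yf yR]] := greedy_recoloring [ffun i => f i] (D := rebels G).
  exact: leq_ltn_trans A3.
have {}yf i : i \notin rebels G -> y i = f i by move/yf->; rewrite ffunE.
have CNR i : i \in conformists G -> i \notin rebels G.
  by move/(disjointFr (conformists_rebels_disjoint G))->.
have SNR i : i \in stubborn G -> i \notin rebels G.
  by move/(disjointFl (rebels_stubborn_disjoint G))->.
have SNC i : i \in stubborn G -> i \in conformists G = false.
  by move/(disjointFl (conformists_stubborn_disjoint G))->.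
exists y; split=> [s|i].
  have sS := valP s; rewrite yf ?SNR // /f SNC // /f0.
  by rewrite valK.
rewrite in_setU => /orP[iC|iR] a; last first.
  by apply: rebel_best_response => // j; apply: yR.
suff [j jN yj] : exists2 j, j \in neighbors G i & y j = y i.
  exact: conformist_best_response jN yj.
have fi := yf i (CNR i iC); rewrite /f iC in fi.
case: pickP fi => [j /setIP[jN jC]|noC] fi.
  (* Since [i] is itself a conformist neighbor of [j], the first branch of [f] applies to [j] too
     and both play [a0]. *)
  exists j => //; rewrite fi yf ?CNR // /f jC.
  by case: pickP => // /(_ i); rewrite in_setI iC neighbors_sym jN.
case: pickP fi => [j /setIP[jN jS]|noS] fi.
  by exists j => //; rewrite fi yf ?SNR // /f SNC.
have /set0Pn[j] := ally i iC; rewrite setIUr in_setU.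
by have /= -> := noC j; have /= -> := noS j.
Qed.

(** Only an inclusion into the edges of a cycle is assumed, which covers lines and rings alike: a
    neighbor carries the next or the previous label cyclically. *)
Lemma degree_le2_of_cyclic (label : 'I_#|N| -> N) : bijective label ->
    (forall e, e \in edges G -> exists k, e = [set label k; label (ordS k)]) ->
  forall i, #|neighbors G i| <= 2.
Proof.
case=> lab' labK lab'K edgeE i.
apply: (@leq_trans #|[set label (ordS (lab' i)); label (ord_pred (lab' i))]|).
  apply: subset_leq_card; apply/subsetP=> j; rewrite inE => /edgeE[k].
  case/set2_eq=> -[-> ->]; rewrite labK ?ordSK.
    exact: set21.
  exact: set22.
by rewrite cards2; case: (_ != _).
Qed.

Lemma line_or_ring_degree_le2 :
  on_line G \/ on_ring G -> forall i, #|neighbors G i| <= 2.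
Proof.
case=> -[label [lab_bij eG]]; apply: (degree_le2_of_cyclic lab_bij); rewrite eG.
  move=> e /imset2P[k l _]; rewrite inE => /eqP lk ->; exists k.
  (* On a line [k.+1] is the label [l], hence below [#|N|], and the cyclic successor does not wrap
     around. *)
  by congr [set _; label _]; apply: val_inj; rewrite /= modn_small -lk.
by move=> e /imsetP[k _ ->]; exists k.
Qed.

Lemma line_or_ring_neighbors_neq0 : 1 < #|N| ->
  on_line G \/ on_ring G -> forall i, neighbors G i != set0.
Proof.
move=> N2 [] [label [[lab' labK lab'K] eG]] i; apply/set0Pn; last first.
  exists (label (ordS (lab' i))); rewrite inE eG; apply/imsetP.
  by exists (lab' i); rewrite ?lab'K.
have [ltk|] := ltnP (lab' i).+1 #|N|.
  exists (label (Ordinal ltk)); rewrite inE eG; apply/imset2P.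
  by apply: (Imset2spec (x1 := lab' i) (x2 := Ordinal ltk));
    rewrite ?inE ?lab'K /=.
(* The last player of a line has no successor, but its label is positive because [1 < #|N|], so the
   predecessor serves. *)
move=> gek; have k0 : 0 < lab' i by rewrite -ltnS; apply: leq_trans gek.
have ltp : (lab' i).-1 < #|N| by apply: leq_ltn_trans (leq_pred _) (ltn_ord _).
exists (label (Ordinal ltp)); rewrite inE eG setUC; apply/imset2P.
by apply: (Imset2spec (x1 := Ordinal ltp) (x2 := lab' i));
  rewrite ?inE ?lab'K //= prednK.
Qed.

End Game.

Theorem theorem4 (m n : nat) (hm : 3 <= m) (hn : 3 <= n)
    (N A : finType) (hN : #|N| = n) (hA : #|A| = m)
    (G : crs_game N A) (hG : on_line G \/ on_ring G) :
  (exists x : {ffun N -> A}, PNE G x) <->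
  (forall i : N, i \in conformists G ->
     neighbors G i :&: (conformists G :|: stubborn G) != set0).
Proof.
have A3 : 2 < #|A| by rewrite hA.
have deg2 := line_or_ring_degree_le2 hG.
split=> [[x xP] i iC|]; last exact: exists_PNE.
apply: (conformist_has_ally_of_PNE _ _ xP iC) => [j|].
  exact: leq_ltn_trans A3.
by apply: (line_or_ring_neighbors_neq0 _ hG); rewrite hN; apply: leq_trans hn.
Qed.
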